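(* Let $\alpha$ be a countable ordinal with finite big Ramsey degrees. Then the ordinal power $\alpha^m$ has finite big Ramsey degrees for every integer $m \ge 1$.
   Context: For a chain (linearly ordered set) $C$ and a finite chain $n=\{0<1<\dots<n-1\}$, let $\mathrm{Emb}(n,C)$ be the set of order embeddings $n \hookrightarrow C$. The big Ramsey degree $T(n,C)$ is the least positive integer $t$ such that for every integer $k \ge 2$ and every coloring $\chi : \mathrm{Emb}(n, C) \to k$ there is a $U \subseteq C$ order-isomorphic to $C$ with $|\chi(\mathrm{Emb}(n, U))| \le t$; if no such $t$ exists, $T(n,C)=\infty$. A chain $C$ has finite big Ramsey degrees if $T(n,C)<\infty$ for all integers $n\ge 1$. Here $\alpha^m = \alpha\cdot\ldots\cdot\alpha$ ($m$ factors) is ordinal exponentiation. *)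

(* Defs.v *)
From HB Require Import structures.
From mathcomp Require Import all_boot all_order.
From mathcomp Require Import boolp classical_sets functions cardinality wochoice.

Set Implicit Arguments.
Unset Strict Implicit.
Unset Printing Implicit Defensive.

Import Order.TTheory.
Local Open Scope classical_set_scope.
Local Open Scope order_scope.

(* Ordinals are represented by order types of well-ordered chains
   (C : orderType d with well_order (<=%O : rel C)). *)

Definition ord_one (d : Order.disp_t) : Type := unit.

HB.instance Definition _ (d : Order.disp_t) := Choice.on (ord_one d).

Section OrdOne.
Variable d : Order.disp_t.
Implicit Types x y z : ord_one d.

Fact ord_one_lt_def x y : false = (y != x) && true.
Proof. by case: x y => [] []. Qed.

Fact ord_one_anti : antisymmetric (fun _ _ : ord_one d => true).
Proof. by case=> [] []. Qed.

Fact ord_one_trans : transitive (fun _ _ : ord_one d => true).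
Proof. by []. Qed.

Fact ord_one_total : total (fun _ _ : ord_one d => true).
Proof. by []. Qed.

HB.instance Definition _ := @Order.isOrder.Build d (ord_one d)
  (fun _ _ => true) (fun _ _ => false) _ _
  ord_one_lt_def (fun _ _ => erefl) (fun _ _ => erefl)
  ord_one_anti ord_one_trans ord_one_total.
End OrdOne.

(* The ordinal product A . B is B copies of A, that is, B * A ordered
   lexicographically with the B component most significant. *)
Definition ord_mul d (A B : orderType d) : orderType d := (B *lexi[d] A)%type.

Fixpoint ord_pow d (A : orderType d) (m : nat) : orderType d :=
  if m is p.+1 then ord_mul (ord_pow A p) A else ord_one d.

Lemma ord_mul_well_order d (A B : orderType d) :
  well_order (<=%O : rel A) -> well_order (<=%O : rel B) ->
  well_order (<=%O : rel (ord_mul A B)).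
Proof.
move=> woA woB; apply: antisymmetric_well_order; first exact: le_anti.
move=> P [[b0 a0] Pba0].
have [|b [[/asboolP[a1 Pba1] minb] _]] := woB [pred b | `[< exists a, (b, a) \in P >]].
  by exists b0; apply/asboolP; exists a0.
have [|a [[Pa mina] _]] := woA [pred a | (b, a) \in P]; first by exists a1.
exists (b, a); split=> // -[b' a'] Pba'; rewrite leEprodlexi /=.
rewrite minb /=; last by apply/asboolP; exists a'.
apply/implyP => le_b'b; apply: mina.
have -> // : b = b' by apply/le_anti; rewrite le_b'b minb //; apply/asboolP; exists a'.
Qed.

Lemma ord_pow_well_order d (A : orderType d) m :
  well_order (<=%O : rel A) -> well_order (<=%O : rel (ord_pow A m)).
Proof.
move=> woA; elim: m => [|m IH]; last exact: ord_mul_well_order.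
apply: antisymmetric_well_order; first exact: le_anti.
by move=> P [x Px]; exists x.
Qed.

Definition Emb (n : nat) d (C : orderType d) : set ('I_n -> C) :=
  [set e | {mono e : i j / i <= j}].
Arguments Emb n {d} C.

(* Emb(n, U), for U a subset of C, as a set of elements of Emb(n, C). *)
Definition Emb_in (n : nat) d (C : orderType d) (U : set C) : set (Emb n C) :=
  [set e | range (val e) `<=` U].

Definition order_isomorphic_subset d (C : orderType d) (U : set C) : Prop :=
  exists f : C -> C, set_bij [set: C] U f /\ {mono f : x y / x <= y}.

Definition big_ramsey_bound (n : nat) d (C : orderType d) (t : nat) : Prop :=
  (0 < t)%N /\
  forall (k : nat), (2 <= k)%N -> forall chi : Emb n C -> 'I_k,
    exists U : set C, order_isomorphic_subset U /\
      ((chi @` Emb_in U)%classic #<= `I_t%classic)%card.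

(* T(n, C), with None standing for infinity. *)
Definition big_ramsey_degree (n : nat) d (C : orderType d) : option nat :=
  if pselect (exists t, `[< big_ramsey_bound n C t >]) is left ex
  then Some (ex_minn ex) else None.

Definition finite_big_ramsey_degrees d (C : orderType d) : Prop :=
  forall n : nat, (1 <= n)%N -> big_ramsey_degree n C <> None.

Lemma big_ramsey_degree_finiteP (n : nat) d (C : orderType d) :
  big_ramsey_degree n C <> None <-> exists t, big_ramsey_bound n C t.
Proof.
rewrite /big_ramsey_degree; case: pselect => [ex|nex]; split=> //.
- by move=> _; have [t /asboolP bt] := ex; exists t.
- by case=> t bt; case: nex; exists t; apply/asboolP.
Qed.

(* Main.v *)
(* Only finiteness of [T(2, alpha)] is needed.  Fix an injection [c] of [alpha] into
   the naturals and attach to [x] the increasing sequence of the values [c z], where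
   [z >= x] and [c z] is least on [x, z]; this realizes [alpha] as a well-founded tree
   of increasing sequences with the Kleene-Brouwer order.  A subset of [alpha] whose
   tree branches infinitely only to bounded depth embeds in a finite power of omega
   (finite sequences of fixed length, ordered lexicographically).  If the depth is
   unbounded, pairs of codes whose oscillation takes any prescribed value can be
   built; colouring pairs by a truncated oscillation, every copy of [alpha] meets all
   nonzero colours, so that [T(2, alpha)] is infinite.  Hence [alpha] embeds in some omega^K,
   and [alpha^m] in omega^(K m).

   Conversely, a chain embedding in omega^K is isomorphic to a proper initial segment
   [{s | s < b}] of some omega^K'.  For increasing [h], applying [h] to the entries of
   [s] after its first difference with [b] gives a copy of the chain in itself, and
   Ramsey's theorem provides an [h] for which the colour of a tuple depends on
   boundedly much information. *)
Require Import Defs.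
From mathcomp Require Import all_boot all_order.
From mathcomp Require Import boolp classical_sets functions cardinality wochoice.
From mathcomp Require Import zify.

Set Implicit Arguments.
Unset Strict Implicit.
Unset Printing Implicit Defensive.

Import Order.TTheory.

(** * Lexicographic order on sequences of naturals *)

Fixpoint lexlt (s t : seq nat) : bool :=
  match s, t with
  | a :: s', b :: t' => (a < b) || ((a == b) && lexlt s' t')
  | _, _ => false
  end.

Lemma lexlt_irr s : lexlt s s = false.
Proof. by elim: s => //= a s ->; rewrite ltnn eqxx. Qed.

Lemma lexlt_trans : transitive lexlt.
Proof.
elim=> [|b t IH] [|a s] [|c u] //=.
case/orP=> [lab|/andP[/eqP-> st]]; case/orP=> [lbc|/andP[/eqP<- tu]].
- by rewrite (ltn_trans lab lbc).
- by rewrite lab.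
- by rewrite lbc.
- by rewrite eqxx (IH _ _ st tu) orbT.
Qed.

Lemma lexlt_total s t : size s = size t -> s != t -> lexlt s t || lexlt t s.
Proof.
elim: s t => [|a s IH] [|b t] //= [szst]; rewrite eqseq_cons.
by case: (ltngtP a b) => //= _; apply: IH.
Qed.

Lemma lexlt_cat p s t : lexlt (p ++ s) (p ++ t) = lexlt s t.
Proof. by elim: p => //= a p ->; rewrite ltnn eqxx. Qed.

Lemma lexlt_cat_l p q s t : size p = size q -> lexlt p q -> lexlt (p ++ s) (q ++ t).
Proof.
elim: p q => [|a p IH] [|b q] //= [szpq].
by case/orP=> [->//|/andP[-> /(IH _ szpq) ->]]; rewrite orbT.
Qed.

Lemma ex_lexlt_min (P : seq nat -> Prop) K :
  (exists2 s, size s = K & P s) ->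
  exists s, [/\ size s = K, P s & forall t, size t = K -> P t -> ~~ lexlt t s].
Proof.
elim: K P => [|K IH] P [s szs Ps].
  by exists s; split=> // t szt _; rewrite (size0nil szs) (size0nil szt).
have ex : exists a, `[< exists2 s', size s' = K & P (a :: s') >].
  case: s szs Ps => // b u [szu] Pu.
  by exists b; apply/asboolP; exists u.
case: (ex_minnP ex) => b /asboolP [u szu Pu] minb.
have [|v [szv Pv minv]] := IH (fun s' => P (b :: s')); first by exists u.
exists (b :: v); split=> //=; first by rewrite szv.
case=> //= c t [szt] Pt; rewrite negb_or -leqNgt minb /=; last first.
  by apply/asboolP; exists t.
by apply/nandP; case: eqP => [ecb|]; [right; apply: minv => //; rewrite -ecb|left].
Qed.

(** * Ramsey's theorem *)

Definition infinite_pred (P : nat -> Prop) := forall N, exists2 x, N <= x & P x.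

Lemma pigeonhole (C : finType) (c : nat -> C) :
  exists v, infinite_pred (fun i => c i = v).
Proof.
apply: contrapT => /forallNP nex.
have /choice[B HB] v : exists N, forall i, N <= i -> c i <> v.
  have /existsNP[N HN] := nex v; exists N => i Ni civ.
  by apply: HN; exists i.
pose M := \max_v B v.
by apply: (HB (c M) M) => //; apply: (leq_bigmax (c M)).
Qed.

Lemma infinite_enum (P : nat -> Prop) : infinite_pred P ->
  exists h : nat -> nat, {homo h : x y / x < y} /\ forall n, P (h n).
Proof.
move=> infP.
have /choice[nx Hnx] N : exists x, N <= x /\ P x by have [x] := infP N; exists x.
pose h n := iter n (fun x => nx x.+1) (nx 0).
exists h; split; last by case=> [|n]; apply: (Hnx _).2.
by apply: homo_ltn => [? ? ?|n]; [apply: ltn_trans|apply: (Hnx _).1].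
Qed.

(** Induction on [N]. Heads [a] are picked one at a time, and each time the reservoir shrinks to one
    on which the colour of [a :: S] is constant. By the pigeonhole principle infinitely many heads
    share this constant. *)
Lemma ramsey_infinite N (C : finType) (col : seq nat -> C) P : infinite_pred P ->
  exists Q c, [/\ infinite_pred Q, forall x, Q x -> P x &
    forall S, sorted ltn S -> size S = N -> (forall x, x \in S -> Q x) -> col S = c].
Proof.
elim: N col P => [|N IH] col P infP.
  by exists P, (col [::]); split=> // S _ /size0nil->.
pose state : Type := nat * (nat -> Prop) * C.
(* The premise makes [R] satisfiable from every state, so that choice yields a total step
   function. *)
pose R (st st' : state) := infinite_pred st.1.2 ->
  [/\ st.1.2 st'.1.1, infinite_pred st'.1.2, forall x, st'.1.2 x -> st.1.2 x /\ st'.1.1 < x &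
  forall S, sorted ltn S -> size S = N -> (forall x, x \in S -> st'.1.2 x) ->
     col (st'.1.1 :: S) = st'.2].
have /choice[F HF] (st : state) : exists st', R st st'.
  case: (pselect (infinite_pred st.1.2)) => [inf|ninf]; last by exists st.
  have [a _ Qa] := inf 0.
  have [|Q [c [infQ subQ HQ]]] := IH (fun S => col (a :: S)) (fun x => st.1.2 x /\ a < x).
    by move=> M; have [x Mx Qx] := inf (maxn M a.+1); exists x; [lia|split=> //; lia].
  by exists (a, Q, c) => _; split.
have [a0 [Q0 [c0 [infQ0 Q0P]]]] : exists (a : nat) (Q : nat -> Prop) (c : C),
  infinite_pred Q /\ forall x, Q x -> P x by exists 0, P, (col [::]).
pose st i := iter i F (a0, Q0, c0).
have infst i : infinite_pred (st i).1.2.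
  by elim: i => // i IHi; have [] := HF (st i) IHi.
pose a i := (st i.+1).1.1.
have aQ i : (st i).1.2 (a i) by have [] := HF (st i) (infst i).
have Qnest i j x : i <= j -> (st j).1.2 x -> (st i).1.2 x.
  move=> /subnK <-; elim: (j - i) x => // n IHn x Qx; apply: IHn.
  by have [_ _ /(_ x Qx)[]] := HF (st (n + i)) (infst _).
have altQ i x : (st i.+1).1.2 x -> a i < x.
  by move=> Qx; have [_ _ /(_ x Qx)[]] := HF (st i) (infst _).
have a_mono i j : i < j -> a i < a j.
  by move=> ij; apply: altQ; apply: (Qnest _ _ _ ij).
have a_lt i j : a i < a j -> i < j.
  case: (ltngtP i j) => // [ji|->]; last by rewrite ltnn.
  by have := a_mono _ _ ji; lia.
have [v infv] := pigeonhole (fun i => (st i.+1).2).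
exists (fun x => exists2 i, x = a i & (st i.+1).2 = v), v; split.
- move=> M; have [i Mi ci] := infv M; exists (a i); last by exists i.
  apply: leq_trans Mi _; elim: i {ci} => // i IHi.
  by apply: leq_ltn_trans IHi (a_mono _ _ (ltnSn i)).
- move=> _ [i -> _]; apply: Q0P; exact: (Qnest 0 i).
- case=> //= x S xS [szS] HS.
  have [i ex ci] := HS x (mem_head _ _).
  have [_ _ _ /(_ S)] := HF (st i) (infst _).
  rewrite -/(a i) -/(st i.+1) ci -ex; apply=> //; first exact: path_sorted xS.
  move=> y yS; have [|j ey _] := HS y; first by rewrite inE yS orbT.
  apply: (Qnest i.+1 j); last by rewrite ey.
  apply: a_lt; rewrite -ex -ey.
  by move: xS; rewrite (path_sortedE ltn_trans) => /andP[/allP/(_ _ yS)].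
Qed.

Lemma ramsey N (C : finType) (col : seq nat -> C) :
  exists h : nat -> nat, {homo h : x y / x < y} /\
    exists c, forall S, sorted ltn S -> size S = N -> col (map h S) = c.
Proof.
have [|Q [c [infQ _ HQ]]] := @ramsey_infinite N C col (fun=> True).
  by move=> M; exists M.
have [h [h_mono hQ]] := infinite_enum infQ.
exists h; split=> //; exists c => S sS szS; apply: HQ.
- exact: (homo_sorted h_mono).
- by rewrite size_map.
- by move=> _ /mapP[y _ ->].
Qed.

(** * Chains that embed in a finite power of omega *)

Lemma lexlt_map h s t : {homo h : x y / x < y} -> lexlt s t -> lexlt (map h s) (map h t).
Proof.
move=> h_mono; elim: s t => [|a s IH] [|b t] //=.
by case/orP=> [/h_mono->//|/andP[/eqP-> /IH->]]; rewrite eqxx orbT.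
Qed.

Definition lex_embeds (K : nat) d (C : orderType d) : Prop :=
  exists f : C -> seq nat,
    (forall x, size (f x) = K) /\ forall x y, (x < y)%O -> lexlt (f x) (f y).

(** [g x] is the least value at [x] among all embeddings. If some [w] below [g y] were missed,
    redirecting to [w] the point with the least [g x] above [w] would give an embedding that is
    smaller at [x]. *)
Lemma lex_collapse K d (C : orderType d) (f0 : C -> seq nat) :
  (forall x, size (f0 x) = K) -> (forall x y, (x < y)%O -> lexlt (f0 x) (f0 y)) ->
  exists g : C -> seq nat, [/\ forall x, size (g x) = K,
    forall x y, (x < y)%O -> lexlt (g x) (g y),
    forall x, ~~ lexlt (f0 x) (g x) &
    forall x s, size s = K -> lexlt s (g x) -> exists z, g z = s].
Proof.
move=> szf0 f0_mono.
pose emb (f : C -> seq nat) :=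
  (forall x, size (f x) = K) /\ forall x y, (x < y)%O -> lexlt (f x) (f y).
have /choice[g Hg] x : exists s, [/\ size s = K, exists2 f, emb f & f x = s &
    forall t, size t = K -> (exists2 f, emb f & f x = t) -> ~~ lexlt t s].
  by apply: ex_lexlt_min; exists (f0 x) => //; exists f0.
have szg x : size (g x) = K by have [] := Hg x.
have g_min x f : emb f -> ~~ lexlt (f x) (g x).
  by move=> ef; have [_ _] := Hg x; apply; [apply: ef.1|exists f].
have g_mono x y : (x < y)%O -> lexlt (g x) (g y).
  move=> xy; have [_ [f ef <-] _] := Hg y; have lf := ef.2 _ _ xy.
  have := g_min x f ef; have [<-//|ne] := eqVneq (f x) (g x).
  have := @lexlt_total (f x) (g x); rewrite ef.1 szg ne => /(_ erefl erefl).
  by case/orP=> [->//|lg _]; apply: lexlt_trans lg lf.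
exists g; split=> //; first by move=> x; apply: g_min.
move=> y w szw wy; apply: contrapT => /forallNP nw.
have [|_ [_ [[x <-] wx] minx]] :=
  @ex_lexlt_min (fun s => (exists x, g x = s) /\ lexlt w s) K.
  by exists (g y) => //; split=> //; exists y.
pose f z := if z == x then w else g z.
have ef : emb f.
  split=> [z|p q pq]; first by rewrite /f; case: ifP.
  rewrite /f; case: (eqVneq p x) => [epx|npx]; case: (eqVneq q x) => [eqx|nqx].
  - by move: pq; rewrite epx eqx ltxx.
  - by apply: lexlt_trans wx _; apply: g_mono; rewrite -epx.
  - have lpx : lexlt (g p) (g x) by apply: g_mono; rewrite -eqx.
    have := @lexlt_total (g p) w; rewrite szg szw => /(_ erefl).
    have /eqP-> : g p <> w by exact: nw.
    move=> /(_ isT)/orP[//|wp].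
    by have := minx (g p) (szg p) (conj (ex_intro _ p erefl) wp); rewrite lpx.
  - exact: g_mono.
by have := g_min x f ef; rewrite /f eqxx wx.
Qed.

(* Prepending [0] to every code makes the range a proper lower set, so that a
   strict bound [b] always exists. *)
Lemma lex_initial_segment K d (C : orderType d) : lex_embeds K C ->
  exists (b : seq nat) (g : C -> seq nat), [/\ size b = K.+1,
    forall x, size (g x) = K.+1, forall x y, (x < y)%O -> lexlt (g x) (g y),
    forall x, lexlt (g x) b &
    forall s, size s = K.+1 -> lexlt s b -> exists x, g x = s].
Proof.
case=> f [szf f_mono].
have [||g [szg g_mono g_le lowg]] := @lex_collapse K.+1 d C (fun x => 0 :: f x).
- by move=> x /=; rewrite szf.
- by move=> x y /f_mono.
have [|b [szb nb minb]] := @ex_lexlt_min (fun s => forall x, g x <> s) K.+1.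
  exists (1 :: nseq K 0); first by rewrite /= size_nseq.
  by move=> x ex; have := g_le x; rewrite ex.
exists b, g; split=> // [x|s szs sb].
  have := @lexlt_total (g x) b; rewrite szg szb => /(_ erefl).
  have /eqP-> : g x <> b by exact: nb.
  by move=> /(_ isT)/orP[//|/(lowg x b szb)[z /nb]].
apply: contrapT => /forallNP ns; have := minb s szs; rewrite sb => H.
by have := H ns.
Qed.

(** * Copies of an initial segment of a power of omega *)

Fixpoint spread (h : nat -> nat) (b s : seq nat) : seq nat :=
  match b, s with
  | b0 :: b', a :: s' => a :: (if a == b0 then spread h b' s' else map h s')
  | _, _ => s
  end.

Lemma size_spread h b s : size (spread h b s) = size s.
Proof.
by elim: b s => [|b0 b IH] [|a s] //=; case: ifP => _; rewrite ?IH ?size_map.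
Qed.

Lemma spread_lexlt h b s t : {homo h : x y / x < y} ->
  lexlt t b -> lexlt s t -> lexlt (spread h b s) (spread h b t).
Proof.
move=> h_mono; elim: b s t => [|b0 b IH] [|a s] [|c t] //=.
case: (ltngtP a c) => //= -> tb st; case: eqP tb => [->|nc].
  by rewrite ltnn /= => tb; apply: IH.
by move=> _; apply: lexlt_map.
Qed.

(** The entry at the first difference is left as it is, and it alone decides the comparison with
    [b]. *)
Lemma spread_bounded h b s : lexlt s b -> lexlt (spread h b s) b.
Proof.
elim: b s => [|b0 b IH] [|a s] //=.
by case: (ltngtP a b0) => //= _; apply: IH.
Qed.

(** The entry [a] at the first difference is less than an entry of [b], hence than [sumn b]. So
    [(i, a)] takes finitely many values and does not depend on [h]. *)
Lemma spread_code b s : lexlt s b -> exists i a, [/\ i < size b, a < sumn b &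
  forall h, spread h b s = take i b ++ a :: drop i.+1 (map h s)].
Proof.
elim: b s => [|b0 b IH] [|a s] //=.
case: (ltngtP a b0) => //= [lab _|-> sb].
  by exists 0, a; split=> // [|h]; [lia|rewrite /= drop0].
have [i [c [ib cb Hs]]] := IH _ sb.
by exists i.+1, c; split=> // [|h]; [lia|rewrite /= Hs].
Qed.

Lemma mem_sumn x S : x \in S -> x <= sumn S.
Proof.
elim: S => // y S IH; rewrite inE -[sumn (y :: S)]/(y + sumn S).
by case/orP=> [/eqP->|/IH]; lia.
Qed.

(** Padding with fresh large values lets Ramsey's theorem, which concerns sets of one fixed size,
    apply to tuples with varying numbers of distinct values. *)
Lemma sorted_superset N (vs : seq nat) : size vs <= N ->
  exists S, [/\ sorted ltn S, size S = N & {subset vs <= S}].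
Proof.
move=> szvs; pose M := (sumn vs).+1.
have ltM x : x \in vs -> x < M by rewrite ltnS; apply: mem_sumn.
have szu : size (undup vs) <= N by apply: leq_trans (size_undup _) szvs.
pose S0 := undup vs ++ iota M (N - size (undup vs)).
exists (sort leq S0); split.
- rewrite ltn_sorted_uniq_leq sort_sorted ?andbT; last exact: leq_total.
  rewrite sort_uniq cat_uniq undup_uniq iota_uniq andbT /=.
  apply/hasPn => x; rewrite mem_iota mem_undup => /andP[Mx _].
  by apply/negP => /ltM; rewrite ltnNge Mx.
- by rewrite size_sort size_cat size_iota subnKC.
- by move=> x xvs; rewrite mem_sort mem_cat mem_undup xvs.
Qed.

(* An [n]-tuple of points of the copy [x |-> dec (l x) (map h (v x))] is determined
   by its labels, by the ranks of its coordinates in their common set of values, and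
   by the image of this set under [h]; the colour does not depend on the last datum. *)
Lemma big_ramsey_bound_of_codes n d (C : orderType d) (L : finType) K
    (l : C -> L) (v : C -> seq nat) (dec : L -> seq nat -> C) :
  (forall x, size (v x) = K) ->
  (forall h, {homo h : x y / x < y} -> forall x y, (x < y)%O ->
     (dec (l x) (map h (v x)) < dec (l y) (map h (v y)))%O) ->
  exists t, big_ramsey_bound n C t.
Proof.
move=> szv dec_mono; pose N := n * K.
(* There are at most [N] values, but sets of size [N.+1] are used because [inord] needs a nonempty
   range of ranks. *)
pose Ty := ({ffun 'I_n -> L} * {ffun 'I_n * 'I_K -> 'I_N.+1})%type.
exists #|{: Ty}|.+1; split=> // k k2 chi.
pose pt (u : Ty) (S : seq nat) i : C :=
  dec (u.1 i) [seq nth 0 S (u.2 (i, j)) | j <- enum 'I_K].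
(* One colour records [chi] for all [u] at once, with [None] where [pt u S] is not an embedding, so
   that a single use of Ramsey's theorem suffices. *)
pose col (S : seq nat) : {ffun Ty -> option 'I_k} := [ffun u =>
  [pick c | `[< exists2 e : Emb n C, val e = pt u S & chi e = c >]]].
have [h [h_mono [F HF]]] := ramsey N.+1 col.
pose g x := dec (l x) (map h (v x)).
have g_mono : {mono g : x y / (x <= y)%O}.
  by apply: le_mono => x y; apply: dec_mono.
exists (range g); split.
  exists g; split=> //; split; first by move=> x _; exists x.
  - by move=> x y _ _; apply: (inc_inj g_mono).
  - by move=> y [x _ <-]; exists x.
have c0 : 'I_k by exists 0; apply: ltnW.
pose G (i : 'I_#|{: Ty}|) := odflt c0 (F (enum_val i)).
suff sub : (chi @` Emb_in (range g) `<=` G @` [set: 'I_#|{: Ty}|])%classic.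
  apply: card_le_trans (subset_card_le sub) _.
  apply: card_le_trans (card_image_le _ _) _.
  by rewrite -(card_le_eql card_II) card_le_II.
move=> _ [e eU <-].
have /choice[x ex] i : exists x, g x = val e i.
  by have [|x _ <-] := eU (val e i); [exists i|exists x].
have [|S [sS szS subS]] := @sorted_superset N.+1 (flatten [seq v (x i) | i <- enum 'I_n]).
  rewrite size_flatten /shape -map_comp (eq_map (g := fun=> K)); last by move=> i /=.
  by rewrite sumnE big_map big_const_seq count_predT size_enum_ord iter_addn_0 /N mulnC.
have inS i y : y \in v (x i) -> y \in S.
  move=> yv; apply/subS/flattenP; exists (v (x i)) => //.
  by apply: map_f; rewrite mem_enum.
pose u : Ty := ([ffun i => l (x i)],
  [ffun ij : 'I_n * 'I_K => inord (index (nth 0 (v (x ij.1)) ij.2) S)]).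
have ptE : val e = pt u (map h S).
  apply/funext => i; rewrite -ex /g /pt /= ffunE; congr dec.
  apply: (@eq_from_nth _ 0); first by rewrite 2!size_map size_enum_ord szv.
  move=> j; rewrite size_map szv => jK.
  rewrite (nth_map 0) ?szv // (nth_map (Ordinal jK)) ?size_enum_ord //.
  have yS : nth 0 (v (x i)) j \in S by apply: (inS i); rewrite mem_nth // szv.
  rewrite ffunE /= nth_enum_ord // inordK; last by rewrite -szS index_mem.
  by rewrite (nth_map 0) ?index_mem // nth_index.
exists (enum_rank u) => //; rewrite /G enum_rankK -(HF S sS szS) ffunE.
case: pickP => [c /asboolP[e' ee' <-] /=|/(_ (chi e))/asboolP[]]; last by exists e.
by congr chi; apply/val_inj; rewrite ee' ptE.
Qed.

(** The self-embeddings are the maps [spread h b], transported to [C] by [g] and its inverse [inv]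
    on the sequences below [b]; [spread_code] supplies the finite labels. *)
Lemma lex_embeds_big_ramsey K d (C : orderType d) :
  lex_embeds K C -> finite_big_ramsey_degrees C.
Proof.
move=> emb n n1; apply/big_ramsey_degree_finiteP.
(* An empty chain has no embedding to colour, since [n >= 1]; otherwise [x0] serves as default value
   of [inv]. *)
case: (pselect (exists x : C, True)) => [[x0 _]|nC]; last first.
  exists 1; split=> // k _ chi; exists [set: C]%classic; split.
    by exists id; split=> //; split=> // x _; exists x.
  have sub : (chi @` Emb_in [set: C] `<=` set0)%classic.
    by move=> c [e _ _]; case: nC; exists (val e (Ordinal n1)).
  by apply: card_le_trans (subset_card_le sub) _; apply: card_ge0.
have [b [g [szb szg g_mono gb low]]] := lex_initial_segment emb.
have /choice[inv Hinv] s : exists x, size s = K.+1 -> lexlt s b -> g x = s.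
  case: (pselect (size s = K.+1 /\ lexlt s b)) => [[szs sb]|ns]; last first.
    by exists x0 => szs sb; case: ns.
  by have [x ex] := low s szs sb; exists x.
have /choice[l Hl] x : exists ia : 'I_(size b) * 'I_(sumn b),
    forall h, spread h b (g x) = take ia.1 b ++ (ia.2 : nat) :: drop ia.1.+1 (map h (g x)).
  have [i [a [ib ab E]]] := spread_code (gb x).
  by exists (Ordinal ib, Ordinal ab).
apply: (big_ramsey_bound_of_codes n (l := l) (v := g) (K := K.+1)
  (dec := fun ia s => inv (take ia.1 b ++ (ia.2 : nat) :: drop ia.1.+1 s))) => // h h_mono x y xy.
rewrite -!Hl ltNge; apply/negP.
have ginv z : g (inv (spread h b (g z))) = spread h b (g z).
  by apply: Hinv; [rewrite size_spread|apply: spread_bounded].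
have lt_xy := spread_lexlt h_mono (gb y) (g_mono _ _ xy).
rewrite le_eqVlt => /orP[/eqP/(congr1 g)|/g_mono].
  by rewrite !ginv => E; move: lt_xy; rewrite E lexlt_irr.
by rewrite !ginv => /(lexlt_trans lt_xy); rewrite lexlt_irr.
Qed.

Lemma lex_embeds_pow K d (C : orderType d) m :
  lex_embeds K C -> lex_embeds (m * K) (ord_pow C m).
Proof.
case=> f [szf f_mono]; elim: m => [|m [g [szg g_mono]]].
  by exists (fun=> [::]); split=> // x y; case: x; case: y.
exists (fun x : C *lexi[d] ord_pow C m => f x.1 ++ g x.2); split=> [x|x y].
  by rewrite size_cat szf szg.
rewrite ltEprodlexi /= => /andP[le1 /implyP lt2].
have [lt1|] := ltP x.1 y.1; first by apply: lexlt_cat_l; [rewrite !szf|apply: f_mono].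
move=> ge1; have -> : x.1 = y.1 by apply/le_anti; rewrite le1.
by rewrite lexlt_cat; apply/g_mono/lt2.
Qed.

Lemma wo_ind d (C : orderType d) (P : C -> Prop) : well_order (<=%O : rel C) ->
  (forall x, (forall y, (y < x)%O -> P y) -> P x) -> forall x, P x.
Proof.
move=> wo IH x; apply: contrapT => nPx.
have [|z [[/asboolP nPz minz] _]] := wo [pred y | `[< ~ P y >]].
  by exists x; apply/asboolP.
apply: nPz; apply: IH => y yz; apply: contrapT => nPy.
by have := minz y; rewrite leNgt yz => H; have := H (introT (asboolP _) nPy).
Qed.

Lemma sorted_catP S T : sorted ltn (S ++ T) ->
  [/\ sorted ltn S, sorted ltn T & forall x y, x \in S -> y \in T -> x < y].
Proof.
rewrite !(sorted_pairwise ltn_trans) pairwise_cat => /and3P[/allrelP H ? ?].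
by split=> // x y /H; apply.
Qed.

(** * Oscillation *)

(* The number of maximal blocks of [S] that are followed by an element of [T]. *)
Definition osc (S T : seq nat) : nat :=
  count (fun a => has (fun b => (a < b) && ~~ has (fun a' => a < a' <= b) S) T) S.

Fixpoint diff_osc (S T : seq nat) : nat :=
  match S, T with
  | a :: S', b :: T' => if a == b then diff_osc S' T' else osc S T
  | _, _ => 0
  end.

Lemma diff_osc_cat p a S b T : a < b ->
  diff_osc (p ++ a :: S) (p ++ b :: T) = osc (a :: S) (b :: T).
Proof. by move=> ab; elim: p => /= [|c p ->]; rewrite ?eqxx // ltn_eqF. Qed.

(** Only the last element of [a :: S1] is followed by [b] before any other element of the first
    sequence, so this block counts once. Elements of [S2] exceed all of [b :: T1] and see only
    [T2]. *)
Lemma osc_cat a S1 S2 b T1 T2 :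
  sorted ltn ((a :: S1) ++ S2) -> sorted ltn ((b :: T1) ++ T2) ->
  (forall x, x \in a :: S1 -> x < b) ->
  (forall x y, x \in S2 -> y \in b :: T1 -> y < x) ->
  osc ((a :: S1) ++ S2) ((b :: T1) ++ T2) = (osc S2 T2).+1.
Proof.
move=> /sorted_catP[sS1 _ S12] /sorted_catP[sT1 _ T12] S1b T1S2.
have leb y : y \in (b :: T1) ++ T2 -> b <= y.
  rewrite mem_cat => /orP[|yT2]; last by apply/ltnW/T12; rewrite ?mem_head.
  rewrite inE => /orP[/eqP->//|yT1]; apply: ltnW.
  by move: sT1; rewrite /= (path_sortedE ltn_trans) => /andP[/allP/(_ _ yT1)].
have eS : a :: S1 = rcons (belast a S1) (last a S1) by rewrite lastI.
move: (belast a S1) (last a S1) eS => S0 l eS; rewrite {}eS in sS1 S12 S1b *.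
have S0l x : x \in S0 -> x < l.
  by move: sS1; rewrite -cats1 => /sorted_catP[_ _ H] xS0; apply: H; rewrite ?mem_head.
have lb : l < b by apply: S1b; rewrite mem_rcons mem_head.
have bT : b \in (b :: T1) ++ T2 by rewrite mem_head.
rewrite {1}/osc; move eS: (rcons S0 l ++ S2) => S; move eT: ((b :: T1) ++ T2) leb bT => T leb bT.
rewrite -{2}eS -cats1 !count_cat [X in X + _ + _](_ : _ = 0); last first.
  rewrite -(count_pred0 S0); apply: eq_in_count => x xS0.
  apply/negbTE/hasPn => y /leb by_; rewrite negb_and negbK; apply/orP; right.
  by apply/hasP; exists l; [rewrite -eS mem_cat mem_rcons mem_head|rewrite S0l //=; lia].
rewrite add0n [count _ [:: l]]/= addn0 -/(osc S2 T2).
have -> : has (fun b' => (l < b') && ~~ has (fun a' => l < a' <= b') S) T.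
  apply/hasP; exists b => //.
  rewrite lb /=; apply/hasPn => x; rewrite -eS mem_cat mem_rcons inE => /orP[/orP[/eqP->|/S0l]|xS2].
  - by rewrite ltnn.
  - by lia.
  - by have := T1S2 x b xS2 (mem_head _ _); lia.
rewrite add1n; congr _.+1; apply: eq_in_count => x xS2.
rewrite -eT has_cat (_ : has _ (b :: T1) = false); last first.
  by apply/negbTE/hasPn => y /(T1S2 _ _ xS2); lia.
rewrite orFb; apply: eq_in_has => y yT2; congr (_ && ~~ _); rewrite -eS has_cat.
rewrite (_ : has _ (rcons S0 l) = false) //.
by apply/negbTE/hasPn => z /S12/(_ xS2); lia.
Qed.

(** * The tree of an enumerated well-order *)

Section TreeCode.
Variables (d : Order.disp_t) (C : orderType d) (c : C -> nat).
Hypotheses (c_inj : injective c) (C_wo : well_order (<=%O : rel C)).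

Definition records (x z : C) : Prop :=
  (x <= z)%O /\ forall w, (x <= w)%O -> (w <= z)%O -> c z <= c w.

(** In increasing order of values the records run from right to left and end with [x] itself, whose
    value [c x] is the largest; hence the range of [iota]. *)
Definition code (x : C) : seq nat :=
  [seq n <- iota 0 (c x).+1 | `[< exists2 z, c z = n & records x z >]].

Lemma code_sorted x : sorted ltn (code x).
Proof. exact/(sorted_filter ltn_trans)/iota_ltn_sorted. Qed.

Lemma mem_codeP x n : reflect (exists2 z, c z = n & records x z) (n \in code x).
Proof.
rewrite mem_filter mem_iota add0n /=.
apply: (iffP andP) => [[/asboolP//]|ex]; split; first exact/asboolP.
by case: ex => z <- [xz minz]; rewrite ltnS; apply: minz.
Qed.

Lemma records_mem x z : records x z <-> c z \in code x.
Proof. by split=> [?|/mem_codeP[w /c_inj->]]//; apply/mem_codeP; exists z. Qed.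

Lemma records_refl x : records x x.
Proof. by split=> // w ? ?; have -> : w = x by apply/le_anti/andP. Qed.

Lemma code_inj : injective code.
Proof.
move=> x y exy; apply/le_anti/andP; split.
  by have [] : records x y by apply/records_mem; rewrite exy; apply/records_mem/records_refl.
by have [] : records y x by apply/records_mem; rewrite -exy; apply/records_mem/records_refl.
Qed.

(** This makes [z] an ancestor of [x]. No value on [[x, z]] is below [c z], so a point beyond [z] of
    value at most [c z] is a record for [x] exactly when it is one for [z]. *)
Lemma code_lower x z : records x z -> code z = [seq n <- code x | n <= c z].
Proof.
move=> xz; have [le_xz minz] := xz.
apply: (irr_sorted_eq ltn_trans ltnn); [exact: code_sorted|exact/(sorted_filter ltn_trans)/code_sorted|].
move=> n; rewrite [RHS]mem_filter; apply/idP/andP => [/mem_codeP[u <- [zu minu]]|[nz /mem_codeP[u eu [xu minu]]]].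
  have uz : c u <= c z by apply: minu.
  split=> //; apply/records_mem; split=> [|w xw wu]; first exact: le_trans zu.
  case/orP: (le_total z w) => [zw|wz]; first exact: minu.
  exact: leq_trans uz (minz _ xw wz).
have zu : (z <= u)%O.
  rewrite leNgt; apply/negP => uz.
  have czu := minz u xu (ltW uz).
  have /c_inj e : c u = c z by apply/eqP; rewrite eqn_leq czu eu nz.
  by move: uz; rewrite e ltxx.
apply/mem_codeP; exists u => //; split=> // w zw wu; apply: minu => //; exact: le_trans zw.
Qed.

Lemma code_prefix x p n q : code x = rcons p n ++ q -> exists z, code z = rcons p n.
Proof.
move=> ex; have /mem_codeP[z ez xz] : n \in code x by rewrite ex mem_cat mem_rcons mem_head.
exists z; rewrite (code_lower xz) ex ez -cats1 !filter_cat.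
have := code_sorted x; rewrite ex -cats1 => /sorted_catP[/sorted_catP[_ _ Hp] _ Hq].
have -> : [seq m <- p | m <= n] = p.
  by apply/all_filterP/allP => m mp; apply/ltnW/Hp; rewrite ?mem_head.
rewrite /= leqnn (_ : filter _ q = [::]) ?cats0 //.
apply/eqP; rewrite -(negbK (_ == _)) -has_filter; apply/hasPn => m mq.
by rewrite -ltnNge; apply: Hq => //; rewrite mem_cat mem_head orbT.
Qed.

Lemma code_ext_lt x z n q : code x = code z ++ n :: q -> (x < z)%O.
Proof.
move=> ex; have [xz _] : records x z.
  by apply/records_mem; rewrite ex mem_cat; apply/orP; left; apply/records_mem/records_refl.
rewrite lt_neqAle xz andbT; apply/eqP => exz; move/(congr1 size): ex.
by rewrite exz size_cat /=; lia.
Qed.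

(** Let [z] be the record of [x] of value [a]. If [y <= x], the point of least value on [[y, z]] is
    a record of [y] of value at most [a < b], so its value lies in [p]. It is then a record of [x]
    before [z] in value, against the minimality of [c z]. *)
Lemma code_diff_lt x y p a b q r :
  code x = p ++ a :: q -> code y = p ++ b :: r -> a < b -> (x < y)%O.
Proof.
move=> ex ey ab; rewrite ltNge; apply/negP => yx.
have /mem_codeP[z ez [xz minz]] : a \in code x by rewrite ex mem_cat mem_head orbT.
have exw : exists n, `[< exists w, [/\ c w = n, (y <= w)%O & (w <= z)%O] >].
  by exists (c z); apply/asboolP; exists z; split=> //; apply: le_trans xz.
case: (ex_minnP exw) => n /asboolP[w [ew yw wz]] minn.
have yrw : records y w.
  split=> // v yv vw; rewrite ew; apply: minn; apply/asboolP; exists v; split=> //.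
  exact: le_trans wz.
have wa : c w <= a.
  by rewrite ew -ez; apply: minn; apply/asboolP; exists z; split=> //; apply: le_trans xz.
have wp : c w \in p.
  have /records_mem := yrw; rewrite ey mem_cat => /orP[//|]; rewrite inE => /orP[/eqP|wr].
    by lia.
  have := code_sorted y; rewrite ey => /sorted_catP[_ /= + _].
  by rewrite (path_sortedE ltn_trans) => /andP[/allP/(_ _ wr)]; lia.
have [xw _] : records x w by apply/records_mem; rewrite ex mem_cat wp.
have := minz w xw wz; have := code_sorted x; rewrite ex => /sorted_catP[_ _ /(_ _ a wp)].
by rewrite mem_head => /(_ isT); lia.
Qed.

(** * Rank of infinite branching *)

Variable X : C -> Prop.

(** Up to finite paths, an infinitely branching tree of height [k] sits above [p] in the tree of
    codes of points of [X]. *)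
Fixpoint fat (k : nat) (p : seq nat) : Prop :=
  if k is k'.+1 then
    exists q, forall N, exists2 j, N <= j & fat k' (rcons (p ++ q) j)
  else exists2 x, X x & exists q, code x = p ++ q.

Lemma fat_prefix k p q : fat k (p ++ q) -> fat k p.
Proof.
case: k => [[x Xx [r]]|k [r H]].
  by rewrite -catA => ?; exists x => //; exists (q ++ r).
by exists (q ++ r) => N; have [j Nj] := H N; rewrite -catA; exists j.
Qed.

Lemma fat_le k l p : k <= l -> fat l p -> fat k p.
Proof.
move=> /subnK <-; elim: (l - k) => // m IH; rewrite addSn => -[q H]; apply: IH.
by have [j _] := H 0; rewrite -cats1 -catA => /fat_prefix.
Qed.

Definition lex_node k p := exists f : C -> seq nat,
  (forall x, size (f x) = k.*2) /\
  forall x y q r, X x -> X y -> code x = p ++ q -> code y = p ++ r -> (x < y)%O ->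
    lexlt (f x) (f y).

(** Each rank costs two coordinates: a head bounded by [m], which lets finitely many children be
    laid out one after another, and an index for the infinitely many remaining children. *)
Definition lex_node_fin k p := exists (m : nat) (l : C -> nat) (f : C -> seq nat),
  [/\ forall x, l x < m, forall x, size (f x) = k.*2.+1 &
  forall x y q r, X x -> X y -> code x = p ++ q -> code y = p ++ r -> (x < y)%O ->
    lexlt (l x :: f x) (l y :: f y)].

(* The finitely many children in which [fat k] holds have codes of bounded head,
   and precede all the other children, which share a single new head. *)
Lemma lex_node_fin_step k p : (forall q, ~ fat k q -> lex_node k q) ->
  ~ fat k.+1 p -> (forall j, lex_node_fin k (rcons p j)) -> lex_node_fin k p.
Proof.
move=> IHk nfat children.
have [N HN] : exists N, forall j, N <= j -> ~ fat k (rcons p j).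
  apply: contrapT => /forallNP H; apply: nfat; exists [::] => N; apply: contrapT => nj.
  by apply: (H N) => j Nj fj; apply: nj; exists j; rewrite ?cats0.
have /choice[F1 HF1] j : exists f, N <= j -> (forall x, size (f x) = k.*2) /\
    forall x y q r, X x -> X y -> code x = rcons p j ++ q -> code y = rcons p j ++ r ->
      (x < y)%O -> lexlt (f x) (f y).
  case: (leqP N j) => [Nj|]; last by exists (fun=> [::]).
  by have [f Hf] := IHk _ (HN j Nj); exists f.
have /choice[m /choice[l /choice[F HF]]] := children.
pose M := \max_(j < N) m j.
have leM j : j < N -> m j <= M by move=> jN; apply: (leq_bigmax (Ordinal jN)).
pose idx x := nth 0 (code x) (size p).
have idxE x a q : code x = p ++ a :: q -> idx x = a.
  by rewrite /idx => ->; rewrite nth_cat ltnn subnn.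
(* Child [j < N] receives heads from [j * M] up to [j.+1 * M] excluded, all later children share
   [N * M], and [p] itself, which follows its descendants in [C], comes last. *)
pose L x := if code x == p then (N * M).+1 else
  if idx x < N then idx x * M + l (idx x) x else N * M.
pose G x := if code x == p then nseq k.*2.+1 0 else
  if idx x < N then F (idx x) x else idx x :: F1 (idx x) x.
have lM j x : j < N -> j * M + l j x < j.+1 * M.
  move=> jN; have [lm _ _] := HF j; have := lm x; have := leM j jN; rewrite mulSn; lia.
have LM x : code x != p -> L x <= N * M.
  move=> /negbTE nx; rewrite /L nx; case: ltnP => // jN; apply: ltnW.
  by apply: leq_trans (lM _ x jN) _; rewrite leq_mul2r jN orbT.
exists (N * M).+2, L, G; split.
- move=> x; have [e|/LM] := eqVneq (code x) p; last by lia.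
  by rewrite /L e eqxx.
- move=> x; rewrite /G; case: eqP => _; first by rewrite size_nseq.
  case: ltnP => jN; first by have [_ -> _] := HF (idx x).
  by rewrite /= (HF1 _ jN).1.
move=> x y q r Xx Xy ex ey xy.
case: q ex => [|a q] ex.
  rewrite cats0 in ex; case: r ey => [|b r] ey.
    by move: xy; rewrite (code_inj (x1 := x) (x2 := y)) ?ltxx // ex ey cats0.
  by have := lt_trans xy (code_ext_lt (etrans ey (congr1 (cat^~ _) (esym ex)))); rewrite ltxx.
have nx : code x != p.
  by apply/eqP => /(congr1 size); rewrite ex size_cat /=; lia.
case: r ey => [|b r] ey.
  by rewrite cats0 in ey; rewrite /= {2}/L {3}/L ey eqxx ltnS LM.
have ny : code y != p.
  by apply/eqP => /(congr1 size); rewrite ey size_cat /=; lia.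
rewrite /L /G (negbTE nx) (negbTE ny) (idxE _ _ _ ex) (idxE _ _ _ ey).
case: (ltngtP a b) => [ab|ba|eab]; first last.
- rewrite eab in ex *.
  have ex' : code x = rcons p b ++ q by rewrite cat_rcons.
  have ey' : code y = rcons p b ++ r by rewrite cat_rcons.
  case: ltnP => bN.
    have [_ _ /(_ x y q r Xx Xy ex' ey' xy)] := HF b.
    by rewrite /= ltn_add2l eqn_add2l.
  by rewrite /= ltnn !eqxx /= ltnn /=; apply: (HF1 b bN).2 ex' ey' xy.
- by have := lt_trans xy (code_diff_lt ey ex ba); rewrite ltxx.
case: (ltnP a N) => aN; case: (ltnP b N) => bN.
- rewrite /= (leq_trans (lM a x aN)) //.
  by apply: leq_trans (leq_addr _ _); rewrite leq_mul2r ab orbT.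
- by rewrite /= (leq_trans (lM a x aN)) // leq_mul2r aN orbT.
- by lia.
- by rewrite /= ltnn eqxx /= ab.
Qed.

(** The outer induction is on the rank [k]. The inner one is on points of [C], since a descendant in
    the tree is smaller than its ancestor. *)
Lemma nonfat_lex_node k p : ~ fat k p -> lex_node k p.
Proof.
elim: k p => [|k IHk] p nfat.
  exists (fun=> [::]); split=> // x y q r Xx _ ex _ _.
  by case: nfat; exists x => //; exists q.
suff [m [l [f [_ szf f_mono]]]] : lex_node_fin k p.
  by exists (fun x => l x :: f x); split=> // x; rewrite /= szf.
(* The sequence [q] is arbitrary because the initial [p] need not be the code of a point. A child
   through which no code passes is vacuous. *)
have children q : ~ fat k.+1 q -> (forall j z, code z = rcons q j -> lex_node_fin k (rcons q j)) ->
    lex_node_fin k q.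
  move=> nf H; apply: lex_node_fin_step => // j.
  case: (pselect (exists x r, code x = rcons q j ++ r)) => [[x [r ex]]|nx].
    by have [z ez] := code_prefix ex; apply: H ez.
  exists 1, (fun=> 0), (fun=> nseq k.*2.+1 0); split=> // [x|x y r s _ _ ex].
    by rewrite size_nseq.
  by case: nx; exists x, r.
have nodes z : ~ fat k.+1 (code z) -> lex_node_fin k (code z).
  move: z; apply: (wo_ind C_wo) => z IHz nf; apply: children => // j u eu.
  rewrite -eu; apply: IHz; first by apply: (@code_ext_lt _ _ j [::]); rewrite cats1.
  by rewrite eu -cats1 => /fat_prefix.
apply: children => // j z ez; rewrite -ez; apply: nodes; rewrite ez -cats1.
by move/fat_prefix.
Qed.

(** Blocks are chosen alternately above [p] and above [q], each starting beyond the sum of the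
    preceding block and hence beyond its entries. Each rank adds one to the oscillation by
    [osc_cat]. *)
Lemma fat_osc r N p q :
  (forall M, exists2 j, M <= j & fat r (rcons p j)) ->
  (forall M, exists2 j, M <= j & fat r (rcons q j)) ->
  exists x y a S b T, [/\ X x, X y, code x = p ++ a :: S, code y = q ++ b :: T &
    [/\ N < a, N < b, a < b & osc (a :: S) (b :: T) = r.+1]].
Proof.
elim: r N p q => [|r IH] N p q Hp Hq.
  have [a Na [x Xx [S]]] := Hp N.+1; rewrite cat_rcons => ex.
  have [b Mb [y Xy [T]]] := Hq (N + sumn (a :: S)).+1; rewrite cat_rcons => ey.
  have ltb u : u \in a :: S -> u < b by move=> /mem_sumn; lia.
  exists x, y, a, S, b, T; split=> //; split=> //; first by lia.
    by apply: ltb; rewrite mem_head.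
  have := code_sorted x; have := code_sorted y; rewrite ex ey.
  move=> /sorted_catP[_ sT _] /sorted_catP[_ sS _].
  by rewrite -[a :: S]cats0 -[b :: T]cats0 osc_cat ?cats0.
have [a Na [S Hp']] := Hp N.+1.
have [b Mb [T Hq']] := Hq (N + sumn (a :: S)).+1.
have ltb u : u \in a :: S -> u < b by move=> /mem_sumn; lia.
have [x [y [a' [S' [b' [T' [Xx Xy ex ey [Na' Nb' ab' eosc]]]]]]]] :=
  IH (sumn (b :: T)) _ _ Hp' Hq'.
move: ex ey; rewrite !cat_rcons -!catA => ex ey.
exists x, y, a, (S ++ a' :: S'), b, (T ++ b' :: T'); split=> //; split=> //; first by lia.
  by apply: ltb; rewrite mem_head.
have := code_sorted x; have := code_sorted y; rewrite ex ey.
move=> /sorted_catP[_ sT _] /sorted_catP[_ sS _].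
rewrite -!cat_cons osc_cat ?eosc // => u v uS' /mem_sumn vb.
apply: leq_ltn_trans vb (leq_trans Na' _); move: uS'.
have /sorted_catP[_ /= sa' _] : sorted ltn ((a :: S) ++ a' :: S') by [].
rewrite inE => /orP[/eqP->//|uS'].
by move: sa'; rewrite (path_sortedE ltn_trans) => /andP[/allP/(_ _ uS')/ltnW].
Qed.

End TreeCode.

(** Truncation at [t.+1] leaves the colours [0] to [t.+1]. If the copy [U] is fat of rank [t.+1] at
    the root, its rank [r.+1] for each [r <= t] realizes the colour [r.+1], and these are [t.+1]
    colours. *)
Lemma big_ramsey_bound_lex_embeds d (C : orderType d) t :
  well_order (<=%O : rel C) -> countable [set: C] -> big_ramsey_bound 2 C t ->
  exists K, lex_embeds K C.
Proof.
move=> wo /countable_injP[c] /in2TT c_inj [_ /(_ t.+2 isT) bound].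
pose chi (e : Emb 2 C) : 'I_t.+2 :=
  inord (minn (diff_osc (code c (val e ord0)) (code c (val e ord_max))) t.+1).
have [U [[g [[gU _ _] g_mono]] cardU]] := bound chi.
have [fatU|nfat] := pselect (fat c U t.+1 [::]); last first.
  have [f [szf f_mono]] := nonfat_lex_node c_inj wo nfat.
  exists t.+1.*2, (f \o g); split=> [x|x y xy] /=; first exact: szf.
  apply: (f_mono _ _ (code c (g x)) (code c (g y))) => //; try exact: gU.
  by rewrite (leW_mono g_mono).
suff sub : ((fun r => inord r.+1 : 'I_t.+2) @` `I_t.+1 `<=` chi @` Emb_in U)%classic.
  have := card_le_trans (subset_card_le sub) cardU.
  rewrite (card_le_eql (inj_card_eq _)) ?card_le_II ?ltnn // => r r' /set_mem/= rt /set_mem/= r't.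
  by move=> /(congr1 (@nat_of_ord _)); rewrite !inordK // => -[].
move=> _ [r /= rt <-].
have [p Hp] : fat c U r.+1 [::] by apply: fat_le fatU.
have [x [y [a [S [b [T [Ux Uy ex ey [_ _ ab eosc]]]]]]]] := fat_osc 0 Hp Hp.
have xy := code_diff_lt c_inj ex ey ab.
pose e (i : 'I_2) := if i == ord0 then x else y.
have eE : e \in Emb 2 C.
  rewrite inE => -[[|[|//]] i] [[|[|//]] j]; rewrite /e /=.
  - by rewrite !lexx.
  - by rewrite (ltW xy).
  - by rewrite leNgt xy.
  - by rewrite !lexx.
exists (SigSub eE).
  by move=> _ [i _ <-] /=; rewrite /e; case: ifP.
rewrite /chi /= /e /= ex ey diff_osc_cat // eosc; congr inord; lia.
Qed.

Theorem theorem5p4 (d : Order.disp_t) (alpha : orderType d)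
    (alpha_wo : well_order (<=%O : rel alpha))
    (alpha_countable : countable [set: alpha]%classic)
    (alpha_fbrd : finite_big_ramsey_degrees alpha)
    (m : nat) (m_ge1 : (1 <= m)%N) :
  finite_big_ramsey_degrees (ord_pow alpha m).
Proof.
have [t bound] := (big_ramsey_degree_finiteP 2 alpha).1 (alpha_fbrd 2 isT).
have [K emb] := big_ramsey_bound_lex_embeds alpha_wo alpha_countable bound.
exact: lex_embeds_big_ramsey (lex_embeds_pow m emb).
Qed.
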